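(* Let $k\ge2$. (1) For any two elements $\varphi,\psi\in M_{k,1}$ with $\varphi\equiv_{\mathcal L}\psi$ and $\varphi>_{\mathcal R}\psi$, there exists $\chi\in M_{k,1}$ such that $\chi\equiv_{\mathcal L}\varphi\equiv_{\mathcal L}\psi$ and $\varphi>_{\mathcal R}\chi>_{\mathcal R}\psi$. (2) For every $\varphi\in M_{k,1}\setminus\{\mathbf 0\}$ there exists $\chi\in M_{k,1}$ such that $\chi\equiv_{\mathcal L}\varphi$ and $\varphi>_{\mathcal R}\chi$. And for every $\psi\in M_{k,1}$ such that $\psi$ is not $\mathcal R$-maximal, there exists $\chi\in M_{k,1}$ such that $\chi\equiv_{\mathcal L}\psi$ and $\chi>_{\mathcal R}\psi$.
   Context: $A$ is an alphabet with $k\ge2$ letters, $A^*$ the free monoid over $A$. A right ideal of $A^*$ is a set $R\subseteq A^*$ with $RA^*\subseteq R$. A right ideal homomorphism is a function $\varphi$ whose domain ${\sf Dom}(\varphi)\subseteq A^*$ is a right ideal, with values in $A^*$ and $\varphi(xw)=\varphi(x)w$ for all $x\in{\sf Dom}(\varphi)$, $w\in A^*$. ${\sf riHom}(A^* )$ is the set of right ideal homomorphisms with finitely generated domain. A right ideal $R'\subseteq R$ is essential in the right ideal $R$ iff $R'$ intersects every nonempty right ideal contained in $R$. $\Phi$ is an essentially equal restriction of $\varphi$ (and $\varphi$ an essentially equal extension of $\Phi$) iff $\Phi$ is a restriction of $\varphi$ and ${\sf Dom}(\Phi)$ is essential in ${\sf Dom}(\varphi)$. Every $\varphi\in{\sf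 riHom}(A^* )$ has a unique maximal essentially equal extension $\max(\varphi)$. The Thompson-Higman monoid is $M_{k,1}=\{\max(\varphi):\varphi\in{\sf riHom}(A^* )\}$ with multiplication $\psi\varphi=\max(\psi\circ\varphi)$ (functions act on the left). $\mathbf 0$ is its zero, the empty function. $u\le_{\mathcal R}v$ means $u=vx$, and $u\le_{\mathcal L}v$ means $u=xv$, for some $x\in M_{k,1}$. For $\mathcal K\in\{\mathcal R,\mathcal L\}$: $u\equiv_{\mathcal K}v$ means $u\le_{\mathcal K}v$ and $v\le_{\mathcal K}u$; $v>_{\mathcal K}u$ means $u\le_{\mathcal K}v$ and not $u\equiv_{\mathcal K}v$. An element is $\mathcal R$-maximal iff no element is $>_{\mathcal R}$ it.
   Formalization: In the second sentence of (2), ψ is additionally assumed to be different from 0, since the claim fails for ψ = 0: 0 is not R-maximal, but its L-class is {0}. *)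

(* Defs.v *)
From mathcomp Require Import all_boot.
From mathcomp Require Import boolp classical_sets functions cardinality.

Set Implicit Arguments.
Unset Strict Implicit.
Unset Printing Implicit Defensive.

Local Open Scope classical_set_scope.

Section ThompsonHigmanMonoid.
Context {A : finType}.

(* The free monoid A^* is [seq A], with concatenation as product. *)
Definition catset (P Q : set (seq A)) : set (seq A) :=
  [set p ++ q | p in P & q in Q].

Definition right_ideal (R : set (seq A)) : Prop := catset R setT `<=` R.

Definition fin_gen (R : set (seq A)) : Prop :=
  exists2 P : set (seq A), finite_set P & R = catset P setT.

Definition essential (R' R : set (seq A)) : Prop :=
  R' `<=` R /\
  forall J, right_ideal J -> J !=set0 -> J `<=` R -> R' `&` J !=set0.

(* Partial functions A^* -> A^*; [None] means undefined. *)
Definition pfun : Type := seq A -> option (seq A).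

Definition dom (f : pfun) : set (seq A) := [set x | isSome (f x)].

Definition restriction (g f : pfun) : Prop := forall x, dom g x -> f x = g x.

Definition right_ideal_hom (f : pfun) : Prop :=
  right_ideal (dom f) /\
  forall x y w, f x = Some y -> f (x ++ w) = Some (y ++ w).

Definition riHom : set pfun :=
  [set f | right_ideal_hom f /\ fin_gen (dom f)].

Definition ess_extension (f g : pfun) : Prop :=
  restriction f g /\ essential (dom f) (dom g).

Definition maximal_ess_extension (f g : pfun) : Prop :=
  [/\ riHom g, ess_extension f g &
      forall h, riHom h -> ess_extension f h -> restriction g h -> h = g].

Definition pzero : pfun := fun=> None.

(* For [f] in [riHom] there is exactly one maximal essentially equal extension,
   so [max_ext f] is that function; the default value [pzero] only matters
   for [f] outside [riHom]. *)
Definition max_ext (f : pfun) : pfun := xget pzero (maximal_ess_extension f).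

Definition Mk1 : set pfun := [set max_ext f | f in riHom].

Definition mulM (g f : pfun) : pfun := max_ext (pcomp g f).

Definition leR (u v : pfun) : Prop := exists2 x, Mk1 x & u = mulM v x.
Definition leL (u v : pfun) : Prop := exists2 x, Mk1 x & u = mulM x v.

Definition eqR (u v : pfun) : Prop := leR u v /\ leR v u.
Definition eqL (u v : pfun) : Prop := leL u v /\ leL v u.

Definition gtR (v u : pfun) : Prop := leR u v /\ ~ eqR u v.

Definition R_maximal (u : pfun) : Prop := ~ exists2 v, Mk1 v & gtR v u.

End ThompsonHigmanMonoid.

Arguments pfun : clear implicits.
Arguments Mk1 : clear implicits.
Arguments pzero : clear implicits.

(* Main.v *)
Require Import Defs.
From mathcomp Require Import all_boot.
From mathcomp Require Import boolp classical_sets cardinality.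

Set Implicit Arguments.
Unset Strict Implicit.
Unset Printing Implicit Defensive.

(* Two elements of [riHom] have the same maximal essentially equal extension
   iff they agree on all sufficiently long words, so an element of the monoid
   may be handled through its values on long words. In this picture
   [u <=_R v] holds iff every value of [u] can be prolonged to a value of [v],
   and left multiplication by a map that is injective on the image of [psi]
   does not change the L-class.
   Let [phi >_R psi <> 0]. Some value [y] of [phi] has no prolongation in the
   image of [psi]; let [s] be a value of [psi] and [a] a letter. The map
   [s a w |-> s w], [s b w |-> y b w] for [b <> a], and identity elsewhere, is
   injective on the image of [psi]; composing it with [psi] adds exactly the
   words [y b w], [b <> a], to the image up to density, so the result lies
   strictly between [psi] and [phi]. This yields (1) and the second half of
   (2). For the first half of (2), prefix all values of [phi] with [y a],
   where [y] is a value of [phi]: the new image misses [y b A^*]. *)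

Local Open Scope classical_set_scope.

Section EventualEquality.
Context {A : finType}.
Implicit Types (f g h u v : pfun A) (p q s t w x y : seq A) (a b : A).

(** * Finitely generated domains seen through truncation of words *)

Lemma bounded_on_short_words (F : seq A -> nat) n :
  exists m, forall x, size x <= n -> F x <= m.
Proof.
exists (\max_(x : n.-bseq A) F x) => x le_xn.
exact: (leq_bigmax_cond (Bseq le_xn)).
Qed.

Lemma finite_short_words n : finite_set [set x : seq A | size x <= n].
Proof.
apply: (sub_finite_set (B := [set val x | x in [set: n.-bseq A]])).
  by move=> x /= le_xn; exists (Bseq le_xn).
by apply: finite_image; exact: finite_finset.
Qed.

(** With [n] the largest length of a generator, membership in the domain is decided by the first [n]
    letters; conversely, the domain words of length at most [n] generate the domain. *)
Lemma riHomP f :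
  riHom f <->
  (forall x y w, f x = Some y -> f (x ++ w) = Some (y ++ w)) /\
  (exists n, forall x y, f x = Some y ->
     exists2 t, f (take n x) = Some t & y = t ++ drop n x).
Proof.
split=> [[[_ homf] [P /finite_seqP[s Ps] domf]]|[homf [n takef]]].
  split=> //; exists (\max_(p <- s) size p) => x y fx; set n := bigop _ _ _.
  have: dom f x by rewrite /dom /= fx.
  rewrite domf => -[p Pp [w _ xE]].
  have le_pn : size p <= n.
    by apply: (leq_bigmax_seq p) => //; move: Pp; rewrite Ps.
  have: dom f (take n x).
    rewrite domf; exists p => //; exists (take (n - size p) w) => //.
    by rewrite -xE take_cat ltnNge le_pn.
  rewrite /dom /=; case ft: (f _) => [t|] // _; exists t => //.
  by apply/Some_inj; rewrite -fx -(homf _ _ _ ft) cat_take_drop.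
have dom_cat x w : dom f x -> dom f (x ++ w).
  by rewrite /dom /=; case fx: (f x) => [y|] // _; rewrite (homf _ _ _ fx).
split.
  by split=> // _ [x domx [w _ <-]]; exact: dom_cat.
exists [set x | size x <= n /\ dom f x].
  by apply: sub_finite_set (finite_short_words n) => x [].
apply/seteqP; split=> [x|_ [x [_ domx] [w _ <-]]]; last exact: dom_cat.
rewrite {1}/dom /=; case fx: (f x) => [y|] // _.
have [t ft _] := takef _ _ fx; exists (take n x).
  by rewrite /dom /= ft size_take_min geq_minl.
by exists (drop n x) => //; rewrite cat_take_drop.
Qed.

Lemma riHom_cat f x y w : riHom f -> f x = Some y -> f (x ++ w) = Some (y ++ w).
Proof. by move=> /riHomP[homf _]; exact: homf. Qed.

Lemma riHom_take f : riHom f -> exists n, forall m, n <= m -> forall x y,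
  f x = Some y -> exists2 t, f (take m x) = Some t & y = t ++ drop m x.
Proof.
move=> rf; have /riHomP[homf [n takef]] := rf; exists n => m le_nm x y fx.
have [t ft yE] := takef _ _ fx.
have ft' : f (take m x) = Some (t ++ drop n (take m x)).
  rewrite -(homf _ _ _ ft) -[X in f X](cat_take_drop n (take m x)).
  by rewrite take_takel.
exists (t ++ drop n (take m x)) => //; apply/Some_inj.
by rewrite -fx -(homf _ _ _ ft') cat_take_drop.
Qed.

(** Letters past a fixed position are copied into the value; hence long words stay long, and
    agreement on long words survives composition. *)
Lemma riHom_size f : riHom f -> forall m, exists n, forall x y,
  n <= size x -> f x = Some y -> m <= size y.
Proof.
move=> /riHom_take[n takef] m; exists (n + m) => x y le_x /(takef n (leqnn n))[t _ ->].
rewrite size_cat size_drop; apply: leq_trans (leq_addl _ _).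
by rewrite leq_subRL // (leq_trans _ le_x) // leq_addr.
Qed.

(** * Eventual equality and the maximal extension *)

(* Essential equality: it coincides with [max_ext f = max_ext g] on [riHom]. *)
Definition ev_eq f g := exists n, forall x, n <= size x -> f x = g x.

Lemma ev_eq_refl f : ev_eq f f. Proof. by exists 0. Qed.

Lemma ev_eq_sym f g : ev_eq f g -> ev_eq g f.
Proof. by case=> n fg; exists n => x /fg. Qed.

Lemma ev_eq_trans f g h : ev_eq f g -> ev_eq g h -> ev_eq f h.
Proof.
case=> n fg [m gh]; exists (maxn n m) => x.
by rewrite geq_max => /andP[/fg-> /gh->].
Qed.

(** Essentiality is tested on the principal ideal of a long [x] in the domain of [g]: [f] is defined
    at some [x ++ w], and truncation brings this back to [x]. *)
Lemma ess_extension_ev_eq f g :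
  riHom f -> riHom g -> ess_extension f g -> ev_eq f g.
Proof.
move=> rf rg [fg [_ ess]]; have [n takef] := riHom_take rf; exists n => x le_nx.
case fx: (f x) => [y|].
  by have := fg x; rewrite /dom /= fx => ->.
case gx: (g x) => [y|] //; exfalso.
have [|||z [domz [q qE [w _ zE]]]] := ess (catset [set x] setT).
- move=> _ [_ [q -> [w _ <-]] [w' _ <-]]; exists x => //; exists (w ++ w') => //.
  by rewrite catA.
- by exists x, x => //; exists [::]; rewrite ?cats0.
- by move=> _ [_ -> [w _ <-]]; rewrite /dom /= (riHom_cat _ rg gx).
move: domz; rewrite /dom /=; case fz: (f z) => [t|] // _.
have [t' ft' _] := takef _ le_nx _ _ fz.
by move: ft'; rewrite -zE qE take_cat ltnn subnn take0 cats0 fx.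
Qed.

(** An explicit formula for [max_ext f], reading only the values of [f] on long words. *)
Definition ev_ext f : pfun A := fun x =>
  xget None [set o | exists y n, o = Some y /\
    forall w, n <= size w -> f (x ++ w) = Some (y ++ w)].

(** The letter [a] yields a word beyond both bounds; cancelling it as a common suffix shows that the
    chosen value is unique. *)
Lemma ev_extP a f x y :
  ev_ext f x = Some y <->
  exists n, forall w, n <= size w -> f (x ++ w) = Some (y ++ w).
Proof.
rewrite /ev_ext; case: xgetP => [_ -> [y' [n' [-> fy']]]|no].
  split=> [[<-]|[n fy]]; first by exists n'.
  have /fy' : n' <= size (nseq (maxn n n') a) by rewrite size_nseq leq_maxr.
  rewrite fy ?size_nseq ?leq_maxl // => -[E].
  have /eqP := congr1 size E; rewrite !size_cat eqn_add2r => /eqP eq_size.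
  by move/eqP: E; rewrite eqseq_cat // => /andP[/eqP->].
by split=> // -[n fy]; case: (no (Some y)); exists y, n.
Qed.

Lemma ev_eq_ext a f g : ev_eq f g -> ev_ext f = ev_ext g.
Proof.
move=> fg; have sub u v x y : ev_eq u v -> ev_ext u x = Some y -> ev_ext v x = Some y.
  case=> n uv /(ev_extP a)[m uy]; apply/(ev_extP a); exists (maxn n m) => w.
  rewrite geq_max => /andP[le_nw le_mw]; rewrite -uv ?uy //.
  by rewrite size_cat (leq_trans le_nw) // leq_addl.
apply/funext => x; case fx: (ev_ext f x) => [y|].
  by rewrite (sub _ _ _ _ fg fx).
case gx: (ev_ext g x) => [y|] //.
by rewrite (sub _ _ _ _ (ev_eq_sym fg) gx) in fx.
Qed.

Lemma ev_ext_restriction a f : riHom f -> restriction f (ev_ext f).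
Proof.
move=> rf x; rewrite /dom /=; case fx: (f x) => [y|] // _.
by apply/(ev_extP a); exists 0 => w _; exact: riHom_cat.
Qed.

Lemma ev_ext_riHom a f : riHom f -> riHom (ev_ext f).
Proof.
move=> rf; have homf x y w : ev_ext f x = Some y -> ev_ext f (x ++ w) = Some (y ++ w).
  move=> /(ev_extP a)[n fy]; apply/(ev_extP a); exists n => w' le_nw'.
  by rewrite -!catA fy // size_cat (leq_trans le_nw') // leq_addl.
apply/riHomP; split=> //; have [n takef] := riHom_take rf; exists n => x y fx.
have [lt_xn|le_nx] := ltnP (size x) n.
  by exists y; rewrite ?take_oversize ?drop_oversize ?cats0 // ltnW.
(* Padding with [a] moves [x] into the domain of [f]; as [n <= size x], cutting at [n] removes the
   padding again. *)
have /(ev_extP a)[m fy] := fx.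
have := fy (nseq m a); rewrite size_nseq leqnn => /(_ isT) fxm.
have [t ft _] := takef _ (leqnn n) _ _ fxm; move: ft; rewrite takel_cat // => ft.
exists t; first by rewrite (ev_ext_restriction a rf) // /dom /= ft.
apply/Some_inj; rewrite -fx -(homf (take n x)) ?cat_take_drop //.
by rewrite (ev_ext_restriction a rf) // /dom /= ft.
Qed.

Lemma ev_ext_essential a f : riHom f -> ess_extension f (ev_ext f).
Proof.
move=> rf; split; first exact: (ev_ext_restriction a).
split=> [x domx|J rJ [x Jx] /(_ _ Jx)].
  by have := ev_ext_restriction a rf domx; move: domx; rewrite /dom /= => domx ->.
rewrite /dom /=; case fx: (ev_ext f x) => [y|] // _.
have /(ev_extP a)[n /(_ (nseq n a))] := fx; rewrite size_nseq leqnn => /(_ isT) fxn.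
exists (x ++ nseq n a); split; first by rewrite /= fxn.
by apply: rJ; exists x => //; exists (nseq n a).
Qed.

Lemma ess_extension_restriction a f h :
  riHom f -> riHom h -> ess_extension f h -> restriction h (ev_ext f).
Proof.
move=> rf rh fh x; rewrite /dom /=; case hx: (h x) => [y|] // _.
have [n eq_fh] := ess_extension_ev_eq rf rh fh.
apply/(ev_extP a); exists n => w le_nw.
by rewrite eq_fh ?(riHom_cat _ rh hx) // size_cat (leq_trans le_nw) // leq_addl.
Qed.

Lemma restriction_antisym g h : restriction g h -> restriction h g -> g = h.
Proof.
move=> gh hg; apply/funext => x; case gx: (g x) => [y|].
  by rewrite gh // /dom /= gx.
by case hx: (h x) => [y|] //; rewrite -gx hg // /dom /= hx.
Qed.

(** [ev_ext f] is an essentially equal extension containing all others, which gives existence and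
    uniqueness of the maximal one. *)
Lemma max_extE a f : riHom f -> max_ext f = ev_ext f.
Proof.
move=> rf; have re := ev_ext_riHom a rf; have ee := ev_ext_essential a rf.
rewrite /max_ext; case: xgetP => [g _ [rg eg maxg]|no].
  by rewrite [ev_ext f]maxg //; exact: (ess_extension_restriction a).
case: (no (ev_ext f)); split=> // h rh eh sub; apply: restriction_antisym => //.
exact: (ess_extension_restriction a).
Qed.

Lemma max_ext_ev_eq a f : riHom f -> ev_eq f (max_ext f).
Proof.
move=> rf; rewrite (max_extE a) //; apply: ess_extension_ev_eq => //.
  exact: (ev_ext_riHom a).
exact: (ev_ext_essential a).
Qed.

(** * Products and the two orders, computed on representatives *)

Lemma Mk1_riHom a f : Mk1 A f -> riHom f.
Proof. by move=> [g rg <-]; rewrite (max_extE a) //; exact: (ev_ext_riHom a). Qed.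

Lemma Mk1_max_ext f : riHom f -> Mk1 A (max_ext f).
Proof. by exists f. Qed.

Lemma Mk1_ev_eq a u f : Mk1 A u -> riHom f -> ev_eq u f -> u = max_ext f.
Proof.
move=> [g rg <-] rf gf; rewrite !(max_extE a) //; apply: (ev_eq_ext a).
apply: ev_eq_trans gf; exact: max_ext_ev_eq.
Qed.

Lemma pcomp_riHom f g : riHom f -> riHom g -> riHom (pcomp g f).
Proof.
move=> rf rg; apply/riHomP; rewrite /pcomp; split=> [x y w|].
  case fx: (f x) => [t|] //= gt.
  by rewrite (riHom_cat _ rf fx) /= (riHom_cat _ rg gt).
have [n takef] := riHom_take rf; have [m takeg] := riHom_take rg.
(* Of the first [n + m] letters the last [m] are copied by [f] into its value, which is then long
   enough to be truncated for [g]. *)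
exists (n + m) => x y; case fx: (f x) => [z|] //= gz.
have [s fs zE] := takef _ (leq_addr m n) _ _ fx.
have [t _ sE] := takef _ (leqnn n) _ _ fs.
rewrite fs /=; have [le_x|lt_x] := leqP (size x) (n + m).
  by exists y; [rewrite -gz zE|]; rewrite drop_oversize ?cats0.
have le_ms : m <= size s.
  by rewrite sE size_cat size_drop size_takel ?(ltnW lt_x) // addKn leq_addl.
have [t' gs yE] := takeg _ le_ms _ _ gz.
by exists t'; [rewrite -gs zE take_size_cat|rewrite yE zE drop_size_cat].
Qed.

Lemma pcomp_ev_eq f f' g g' :
  riHom f -> ev_eq f f' -> ev_eq g g' -> ev_eq (pcomp g f) (pcomp g' f').
Proof.
move=> rf [n ff'] [m gg']; have [l sizef] := riHom_size rf m.
exists (maxn n l) => x; rewrite geq_max => /andP[le_nx le_lx].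
rewrite /pcomp -ff' //; case fx: (f x) => [y|] //=.
by rewrite gg' //; exact: (sizef x).
Qed.

Lemma ev_eq_mulM a u v f g : riHom u -> riHom v -> ev_eq u f -> ev_eq v g ->
  ev_eq (mulM v u) (pcomp g f).
Proof.
move=> ru rv uf vg; apply: ev_eq_trans (pcomp_ev_eq ru uf vg).
by apply/ev_eq_sym/(max_ext_ev_eq a)/pcomp_riHom.
Qed.

Lemma mulM_max_ext a f g : riHom f -> riHom g ->
  Mk1 A (mulM (max_ext g) f) /\ ev_eq (mulM (max_ext g) f) (pcomp g f).
Proof.
move=> rf rg; have rmg : riHom (max_ext g) by exact/(Mk1_riHom a)/Mk1_max_ext.
split; first exact/Mk1_max_ext/pcomp_riHom.
by apply: (ev_eq_mulM a) => //; [exact: ev_eq_refl|exact/ev_eq_sym/(max_ext_ev_eq a)].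
Qed.

(** Multipliers may range over [riHom], since passing to the maximal extension keeps the values on
    long words. *)
Lemma leRP a u v : Mk1 A u -> Mk1 A v ->
  leR u v <-> exists2 x, riHom x & ev_eq u (pcomp v x).
Proof.
move=> Mu Mv; have rv := Mk1_riHom a Mv.
split=> [[x Mx ->]|[x rx uvx]].
  exists x; first exact: (Mk1_riHom a).
  by apply: (ev_eq_mulM a) => //; [exact: (Mk1_riHom a)|exact: ev_eq_refl..].
exists (max_ext x); first exact: Mk1_max_ext.
have rmx : riHom (max_ext x) by exact/(Mk1_riHom a)/Mk1_max_ext.
apply: (Mk1_ev_eq a) => //; first exact: pcomp_riHom.
apply: ev_eq_trans uvx _; apply: (pcomp_ev_eq rx); last exact: ev_eq_refl.
exact: (max_ext_ev_eq a).
Qed.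

Lemma leLP a u v : Mk1 A u -> Mk1 A v ->
  leL u v <-> exists2 x, riHom x & ev_eq u (pcomp x v).
Proof.
move=> Mu Mv; have rv := Mk1_riHom a Mv.
split=> [[x Mx ->]|[x rx uxv]].
  exists x; first exact: (Mk1_riHom a).
  by apply: (ev_eq_mulM a) => //; [exact: (Mk1_riHom a)|exact: ev_eq_refl..].
exists (max_ext x); first exact: Mk1_max_ext.
have rmx : riHom (max_ext x) by exact/(Mk1_riHom a)/Mk1_max_ext.
apply: (Mk1_ev_eq a) => //; first exact: pcomp_riHom.
apply: ev_eq_trans uxv _; apply: (pcomp_ev_eq rv); first exact: ev_eq_refl.
exact: (max_ext_ev_eq a).
Qed.

Lemma leL_trans a u v h : Mk1 A u -> Mk1 A v -> Mk1 A h ->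
  leL u v -> leL v h -> leL u h.
Proof.
move=> Mu Mv Mh /(leLP a Mu Mv)[x rx uxv] /(leLP a Mv Mh)[y ry vyh].
apply/(leLP a Mu Mh); exists (pcomp x y); first exact: pcomp_riHom.
apply: ev_eq_trans uxv (ev_eq_trans (pcomp_ev_eq (Mk1_riHom a Mv) vyh (ev_eq_refl x)) _).
by exists 0 => p _; rewrite /pcomp; case: (h p).
Qed.

(** * The R-order and images *)

(** [m] bounds the values at words of length at most [n]; whatever exceeds it was copied from the
    argument and can be cut off there. *)
Lemma riHom_image_take v : riHom v ->
  exists m, forall q y, v q = Some y -> exists q', v q' = Some (take m y).
Proof.
move=> rv; have [n takev] := riHom_take rv.
have [m le_m] := bounded_on_short_words (fun q => size (odflt [::] (v q))) n.
exists m => q y vq; have [t vt yE] := takev _ (leqnn n) _ _ vq.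
have le_tm : size t <= m.
  by have := le_m (take n q); rewrite vt; apply; rewrite size_take_min geq_minl.
exists (take n q ++ take (m - size t) (drop n q)).
by rewrite (riHom_cat _ rv vt) yE take_cat ltnNge le_tm.
Qed.

Lemma drop_cat_long n x w : n <= size x -> drop n (x ++ w) = drop n x ++ w.
Proof.
by move=> le_nx; rewrite -{1}(cat_take_drop n x) -catA drop_size_cat ?size_takel.
Qed.

(* The [R]-order is inclusion of images up to density. *)
Lemma leR_imageP a u v : Mk1 A u -> Mk1 A v ->
  leR u v <-> forall p t, u p = Some t -> exists w q, v q = Some (t ++ w).
Proof.
move=> Mu Mv; have ru := Mk1_riHom a Mu; have rv := Mk1_riHom a Mv.
split=> [/(leRP a Mu Mv)[x rx [n uvx]] p t up|im].
  have := uvx (p ++ nseq n a); rewrite size_cat size_nseq leq_addl => /(_ isT).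
  rewrite (riHom_cat _ ru up) /pcomp; case xp: (x _) => [q|] //= vq.
  by exists (nseq n a), q.
have [m takev] := riHom_image_take rv; have [n sizeu] := riHom_size ru m.
have [l takeu] := riHom_take ru; pose N := maxn n l.
(* [z] replaces the first [N] letters by a [v]-preimage of their [u]-value. [N] makes this value at
   least [m] long and suffices to decide the domain of [u]. *)
pose z p := if (N <= size p) && isSome (u (take N p))
  then Some (xget [::] [set q | v q = u (take N p)] ++ drop N p) else None.
apply/(leRP a Mu Mv); exists z.
  apply/riHomP; split=> [p q w|].
    rewrite /z; case: ifP => // /andP[le_Np up] [<-].
    rewrite size_cat (leq_trans le_Np) ?leq_addr //= takel_cat // up.
    by rewrite drop_cat_long // catA.
  exists N => p q; rewrite /z; case: ifP => // /andP[le_Np up] [<-].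
  rewrite size_takel // leqnn take_takel // up drop_oversize ?size_takel //.
  by rewrite cats0; eexists.
exists N => p le_Np; rewrite /pcomp /z le_Np /=; case ut: (u (take N p)) => [t|] /=.
  have up : u p = Some (t ++ drop N p) by rewrite -(riHom_cat _ ru ut) cat_take_drop.
  have le_mt : m <= size t.
    by apply: (sizeu (take N p)) => //; rewrite size_takel // leq_maxl.
  (* Only a prolongation [t ++ w] is known to be a value of [v]. Cutting it at [m <= size t]
     discards [w], and appending [drop m t] restores [t]; so [xget] does find a preimage. *)
  have [w [q vq]] := im _ _ ut; have [q' vq'] := takev _ _ vq.
  have /(@xgetI _ [::]) /= vt : [set q | v q = Some t] (q' ++ drop m t).
    by rewrite /= (riHom_cat _ rv vq') takel_cat // cat_take_drop.
  by rewrite (riHom_cat _ rv vt) up.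
case up: (u p) => [y|] //; have [|t ut'] := takeu N _ _ _ up; first exact: leq_maxr.
by rewrite ut in ut'.
Qed.

(** * Multipliers given by prefix replacement on long words *)

Lemma riHom_long_words (F : seq A -> seq A) n :
  (forall x w, n <= size x -> F (x ++ w) = F x ++ w) ->
  riHom (fun x => if n <= size x then Some (F x) else None).
Proof.
move=> Fcat; apply/riHomP; split=> [x y w|].
  case: ifP => // le_nx [<-]; rewrite size_cat (leq_trans le_nx) ?leq_addr //.
  by rewrite Fcat.
exists n => x y; case: ifP => // le_nx [<-]; exists (F (take n x)).
  by rewrite size_takel // leqnn.
by rewrite -Fcat ?size_takel // cat_take_drop.
Qed.

Lemma prefix_cat_long s x w : size s <= size x -> prefix s (x ++ w) = prefix s x.
Proof. by move=> le_sx; rewrite !prefixE takel_cat. Qed.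

(* When [s] and [y] are prefix-incomparable, [unspread a s y] inverts
   [spread a s y] on the words of which [y] is not a prefix. *)
Definition spread a s y x : seq A :=
  if prefix (rcons s a) x then s ++ drop (size s).+1 x
  else if prefix s x then y ++ drop (size s) x else x.

Definition unspread a s y x : seq A :=
  if prefix y x then s ++ drop (size y) x
  else if prefix s x then rcons s a ++ drop (size s) x else x.

Lemma spread_cat a s y x w :
  size s < size x -> spread a s y (x ++ w) = spread a s y x ++ w.
Proof.
move=> lt_sx; rewrite /spread !prefix_cat_long ?size_rcons // 1?ltnW //.
by rewrite !drop_cat_long // 1?ltnW //; case: ifP; [|case: ifP]; rewrite ?catA.
Qed.

Lemma unspread_cat a s y x w : maxn (size s) (size y) <= size x ->
  unspread a s y (x ++ w) = unspread a s y x ++ w.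
Proof.
rewrite geq_max => /andP[le_sx le_yx]; rewrite /unspread !prefix_cat_long //.
by rewrite !drop_cat_long //; case: ifP; [|case: ifP]; rewrite ?catA.
Qed.

Lemma spread_eq a s y w : spread a s y (s ++ a :: w) = s ++ w.
Proof.
rewrite /spread -cat_rcons prefix_prefix drop_size_cat //.
by rewrite size_rcons.
Qed.

Lemma spread_neq a b s y w : b != a -> spread a s y (s ++ b :: w) = y ++ b :: w.
Proof.
move=> ba; rewrite /spread prefix_prefix (drop_size_cat _ (erefl (size s))).
by rewrite -cats1 prefix_catr // eqxx /= eq_sym (negbTE ba).
Qed.

Lemma spread_id a s y t : ~~ prefix s t -> spread a s y t = t.
Proof.
move=> st; rewrite /spread (negbTE st); case: ifP => // /prefixP[w tE].
by move: st; rewrite tE -cats1 -catA prefix_prefix.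
Qed.

Lemma spread_cases a s t : size s < size t ->
  [\/ exists w, t = s ++ a :: w,
      exists b w, b != a /\ t = s ++ b :: w | ~~ prefix s t].
Proof.
move=> lt_st; have [/prefixP[[|b w] tE]|] := boolP (prefix s t); last by constructor 3.
  by move: lt_st; rewrite tE cats0 ltnn.
have [ba|ba] := eqVneq b a; last by constructor 2; exists b, w.
by constructor 1; exists w; rewrite tE ba.
Qed.

(** * Construction of the elements [chi] *)

Lemma not_leR_image a u v : Mk1 A u -> Mk1 A v -> ~ leR u v ->
  exists p t, u p = Some t /\ forall w q, v q <> Some (t ++ w).
Proof.
move=> Mu Mv nuv; apply: contrapT => no; apply: nuv; apply/(leR_imageP a) => // p t up.
apply: contrapT => no'; apply: no; exists p, t; split=> // w q vq.
by apply: no'; exists w, q.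
Qed.

Lemma neq_pzero u : u <> pzero A -> exists p t, u p = Some t.
Proof.
move=> u0; apply: contrapT => no; apply: u0; apply/funext => p.
by case up: (u p) => [t|] //; case: no; exists p, t.
Qed.

(** L-equivalence is asserted with [psi] alone, so that the lemma serves both the density claim and
    the ascent from a non-maximal element. *)
Lemma gtR_dense a b phi psi : b != a -> Mk1 A phi -> Mk1 A psi ->
  psi <> pzero A -> gtR phi psi ->
  exists chi, [/\ Mk1 A chi, eqL chi psi, gtR phi chi & gtR chi psi].
Proof.
move=> ba Mphi Mpsi /neq_pzero[p0 [s psi_s]] [le_psi_phi n_eqR].
have [|p1 [y [phi_y noy]]] := not_leR_image a Mphi Mpsi; first by move=> ?; apply: n_eqR.
have rphi := Mk1_riHom a Mphi; have rpsi := Mk1_riHom a Mpsi.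
pose x t := if size s < size t then Some (spread a s y t) else None.
pose x' t := if maxn (size s) (size y) <= size t
  then Some (unspread a s y t) else None.
have rx : riHom x by apply: riHom_long_words => t w; exact: spread_cat.
have rx' : riHom x' by apply: riHom_long_words => t w; exact: unspread_cat.
have psi_sw w : psi (p0 ++ w) = Some (s ++ w) by rewrite (riHom_cat _ rpsi psi_s).
(* Every [s ++ w] is a value of [psi], so [s] and [y] are prefix-incomparable. *)
have nos w w' : s ++ w <> y ++ w' by move=> E; apply: (noy w' (p0 ++ w)); rewrite -E.
have noyt q t : psi q = Some t -> ~~ prefix y t.
  by move=> psi_t; apply/prefixP => -[w E]; apply: (noy w q); rewrite -E.
pose chi := mulM (max_ext x) psi.
have [Mchi chiE] : Mk1 A chi /\ ev_eq chi (pcomp x psi) by exact: mulM_max_ext.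
have rchi := Mk1_riHom a Mchi.
(* The length bound keeps the spread value in the domain of [x']: trading [s] for [y] loses at most
   [size s] letters, and deleting [a] loses one, which the strict inequality absorbs. *)
have [n chi_psi] : exists n, forall p, n <= size p ->
    chi p = omap (spread a s y) (psi p) /\
    forall t, psi p = Some t -> size s + maxn (size s) (size y) < size t.
  have [n chi_n] := chiE.
  have [m sizepsi] := riHom_size rpsi (size s + maxn (size s) (size y)).+1.
  exists (maxn n m) => p; rewrite geq_max => /andP[le_np le_mp].
  have lt_t t : psi p = Some t -> size s + maxn (size s) (size y) < size t by exact: sizepsi.
  split=> //; rewrite chi_n // /pcomp; case psi_t: (psi p) => [t|] //=.
  by rewrite /x (leq_ltn_trans (leq_addr _ _) (lt_t _ psi_t)).
(* Padding by [l] reaches the range where [chi] is known; the image criterion allows such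
   prolongations. *)
pose l := nseq n a.
have le_nl p : n <= size (p ++ l) by rewrite size_cat size_nseq leq_addl.
have chi_spread p t : psi (p ++ l) = Some t -> chi (p ++ l) = Some (spread a s y t).
  by move=> psi_t; have [-> _] := chi_psi _ (le_nl p); rewrite psi_t.
have le_chi_psi : leR psi chi.
  apply/(leR_imageP a) => // p t psi_t.
  have psi_tl := riHom_cat l rpsi psi_t.
  have [/prefixP[w tlE]|nst] := boolP (prefix s (t ++ l)).
    (* Here [psi] takes the value [s ++ a :: w ++ l], from which [spread] deletes the [a]. *)
    exists (l ++ l), ((p0 ++ a :: w) ++ l).
    by rewrite (chi_spread _ (s ++ a :: w ++ l)) ?spread_eq -?catA ?psi_sw // !catA tlE.
  by exists l, (p ++ l); rewrite (chi_spread _ _ psi_tl) spread_id.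
have le_chi_phi : leR chi phi.
  apply/(leR_imageP a) => // p c chi_c.
  have := chi_psi _ (le_nl p); rewrite (riHom_cat _ rchi chi_c).
  case psi_t: (psi (p ++ l)) => [t|] /= -[] // [cE] /(_ _ erefl) lt_t.
  have /(leR_imageP a) im := le_psi_phi.
  (* The first and third cases give values of [psi], which [phi] reaches up to prolongation; the
     second gives a prolongation of the value [y] of [phi]. *)
  have [|[w tE]|[b' [w [b'a tE]]]|nst] := @spread_cases a s t.
  - exact: leq_ltn_trans (leq_addr _ _) lt_t.
  - have [//|//|w' [q phi_q]] := im _ _ _ _ (psi_sw w).
    by exists (l ++ w'), q; rewrite catA cE tE spread_eq.
  - exists l, (p1 ++ b' :: w).
    by rewrite (riHom_cat _ rphi phi_y) cE tE spread_neq.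
  - have [//|//|w' [q phi_q]] := im _ _ _ _ psi_t.
    by exists (l ++ w'), q; rewrite catA cE spread_id.
exists chi; split=> //.
- split; apply/(leLP a) => //; first by exists x.
  exists x' => //; exists n => p le_np; have [chi_p lt_p] := chi_psi _ le_np.
  rewrite /pcomp chi_p; case psi_t: (psi p) => [t|] //=.
  have lt_t := lt_p _ psi_t.
  have [|[w tE]|[b' [w [b'a tE]]]|nst] := @spread_cases a s t.
  + exact: leq_ltn_trans (leq_addr _ _) lt_t.
  + have le_w : maxn (size s) (size y) <= size (s ++ w).
      move: lt_t; rewrite tE !size_cat ltn_add2l ltnS => /leq_trans-> //.
      exact: leq_addl.
    rewrite tE spread_eq /x' le_w /unspread (negbTE (noyt _ _ (psi_sw w))).
    by rewrite prefix_prefix drop_size_cat // cat_rcons.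
  + have le_w : maxn (size s) (size y) <= size (y ++ b' :: w).
      move: lt_t; rewrite tE !size_cat ltn_add2l => /ltnW/leq_trans-> //.
      exact: leq_addl.
    rewrite tE spread_neq // /x' le_w /unspread prefix_prefix.
    by rewrite drop_size_cat.
  + have le_t : maxn (size s) (size y) <= size t.
      by apply: leq_trans (ltnW lt_t); exact: leq_addl.
    by rewrite spread_id // /x' le_t /unspread (negbTE (noyt _ _ psi_t)) (negbTE nst).
- split=> // -[_ /(leR_imageP a) im].
  (* The value [y a] of [phi] separates: [spread] produces only values of [psi] and words [y b' w]
     with [b' != a]. *)
  have [//|//|w [q chi_q]] := im _ _ _ _ (riHom_cat [:: a] rphi phi_y).
  have := chi_psi _ (le_nl q); rewrite (riHom_cat _ rchi chi_q).
  case psi_t: (psi (q ++ l)) => [t|] /= -[] // [cE] /(_ _ erefl) lt_t.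
  move: cE; rewrite -!catA /=.
  have [|[w' tE]|[b' [w' [b'a tE]]]|nst] := @spread_cases a s t.
  + exact: leq_ltn_trans (leq_addr _ _) lt_t.
  + by rewrite tE spread_eq => /esym/nos.
  + rewrite tE spread_neq // => /eqP; rewrite eqseq_cat // eqxx /= eqseq_cons.
    by rewrite eq_sym (negbTE b'a).
  + by rewrite spread_id // => tE; apply: (noy _ _ (etrans psi_t (congr1 Some (esym tE)))).
- split=> // -[_ /(leR_imageP a) im].
  (* The second letter [b] puts a prolongation of [y] into the image of [chi]. *)
  have psi_b : psi ((p0 ++ [:: b]) ++ l) = Some (s ++ b :: l) by rewrite -catA psi_sw.
  have [//|//|w [q psi_q]] := im _ _ _ _ (chi_spread _ _ psi_b).
  by apply: (noy (b :: l ++ w) q); rewrite psi_q spread_neq // -catA.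
Qed.

(** A composite with the empty function is empty, so the zero is alone in its L-class; hence the
    ascent in (2) is stated for nonzero [psi]. *)
Lemma eqL_neq_pzero a u v : Mk1 A u -> Mk1 A v -> eqL u v ->
  u <> pzero A -> v <> pzero A.
Proof.
move=> Mu Mv [/(leLP a Mu Mv)[x _ [n uxv]] _] /neq_pzero[p [t up]] v0.
have := uxv (p ++ nseq n a); rewrite size_cat size_nseq leq_addl => /(_ isT).
by rewrite (riHom_cat _ (Mk1_riHom a Mu) up) v0.
Qed.

Lemma gtR_neq_pzero a u v : Mk1 A u -> Mk1 A v -> gtR u v -> u <> pzero A.
Proof.
move=> Mu Mv [vu n_eqR] u0; apply: n_eqR; split=> //.
by apply/(leR_imageP a) => // p t; rewrite u0.
Qed.

Lemma exists_gtR_below a b phi : b != a -> Mk1 A phi -> phi <> pzero A ->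
  exists chi, [/\ Mk1 A chi, eqL chi phi & gtR phi chi].
Proof.
move=> ba Mphi /neq_pzero[p0 [y phi_y]]; have rphi := Mk1_riHom a Mphi.
(* The test [0 <= size t] always holds; it gives [x] the shape required by [riHom_long_words]. *)
pose u := rcons y a; pose x t := if 0 <= size t then Some (u ++ t) else None.
pose x' t := if size u <= size t then Some (drop (size u) t) else None.
have rx : riHom x by apply: (@riHom_long_words (cat u) 0) => t w _; rewrite catA.
have rx' : riHom x' by apply: riHom_long_words => t w; exact: drop_cat_long.
pose chi := mulM (max_ext x) phi.
have [Mchi chiE] : Mk1 A chi /\ ev_eq chi (pcomp x phi) by exact: mulM_max_ext.
have rchi := Mk1_riHom a Mchi.
(* [chi] agrees with the composite only on long words, so its values are compared with [y a] after
   padding. *)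
have chi_cat p t : chi p = Some t -> exists w w', t ++ w = y ++ a :: w'.
  move=> chi_t; have [n /(_ (p ++ nseq n a))] := chiE.
  rewrite size_cat size_nseq leq_addl (riHom_cat _ rchi chi_t) => /(_ isT).
  rewrite /pcomp; case: (phi _) => [c|] //= -[tE]; exists (nseq n a), c.
  by rewrite tE /u cat_rcons.
exists chi; split=> //.
  split; apply/(leLP a) => //; first by exists x.
  exists x' => //; have [n chi_n] := chiE; exists n => p le_np.
  rewrite /pcomp chi_n // /pcomp; case: (phi p) => [t|] //=.
  by rewrite /x' size_cat leq_addr drop_size_cat.
split.
  apply/(leR_imageP a) => // p t /chi_cat[w [w' tE]].
  by exists w, (p0 ++ a :: w'); rewrite tE (riHom_cat _ rphi phi_y).
move=> [_ /(leR_imageP a) im].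
have [//|//|w [q chi_q]] := im _ _ _ _ (riHom_cat [:: b] rphi phi_y).
have [v [v']] := chi_cat _ _ chi_q; rewrite -!catA => /eqP.
by rewrite eqseq_cat // eqxx /= eqseq_cons (negbTE ba).
Qed.

End EventualEquality.

Theorem proposition4p8 (k : nat) (A : finType) (hk : 2 <= k) (hA : #|A| = k) :
  (forall phi psi : pfun A, Mk1 A phi -> Mk1 A psi ->
     eqL phi psi -> gtR phi psi ->
     exists chi : pfun A, [/\ Mk1 A chi, eqL chi phi, eqL phi psi,
                             gtR phi chi & gtR chi psi])
  /\
  ((forall phi : pfun A, Mk1 A phi -> phi <> pzero A ->
      exists chi : pfun A, [/\ Mk1 A chi, eqL chi phi & gtR phi chi])
   /\
   (forall psi : pfun A, Mk1 A psi -> psi <> pzero A -> ~ R_maximal psi ->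
      exists chi : pfun A, [/\ Mk1 A chi, eqL chi psi & gtR chi psi])).
Proof.
have /card_gt1P[a [b [_ _ ab]]] : 1 < #|A| by rewrite hA.
have ba : b != a by rewrite eq_sym.
split; [|split] => [phi psi Mphi Mpsi L_phi_psi R_phi_psi|phi Mphi phi0|psi Mpsi psi0 nmax].
(* The zero is R-below everything, so [phi] is nonzero, and L-equivalence passes this on to
   [psi]. *)
- have psi0 : psi <> pzero A.
    by apply: (eqL_neq_pzero a Mphi) => //; exact: (gtR_neq_pzero a _ Mpsi).
  have [chi [Mchi [chi_psi psi_chi] R1 R2]] := gtR_dense ba Mphi Mpsi psi0 R_phi_psi.
  have [phi_psi psi_phi] := L_phi_psi.
  exists chi; split=> //; split; exact: (leL_trans a _ Mpsi).
- exact: exists_gtR_below ba Mphi phi0.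
- have [v Mv R_v_psi] := contrapT nmax.
  by have [chi [Mchi L_chi _ R_chi]] := gtR_dense ba Mv Mpsi psi0 R_v_psi; exists chi.
Qed.
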